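(* For every integer $k\ge1$, \[s_{k^k}(A)=s_{(k-1)^k}(A)=(-q)^{\binom{k}{2}},\] that is, $\det\big(C_{k-i+j}(q)\big)_{1\le i,j\le k}=\det\big(C_{k-1-i+j}(q)\big)_{1\le i,j\le k}=(-q)^{k(k-1)/2}$.
   Context: $q$ is an indeterminate. The Narayana polynomials are $C_0(q)=1$ and $C_n(q)=\sum_{k=1}^n \frac1n\binom{n}{k-1}\binom{n}{k}q^{k-1}$ for $n\ge1$. The ''Narayana alphabet'' $A$ is the specialization of the ring of symmetric functions (over $\mathbb{Q}$) to $\mathbb{Q}[q]$ sending the complete symmetric function $h_n$ to $h_n(A)=C_n(q)$ for all $n\ge0$ (and $h_n(A)=0$ for $n<0$). For a partition $\lambda$, $s_\lambda(A)$ is the image of the Schur function, given by the Jacobi–Trudi formula $s_\lambda(A)=\det\big(h_{\lambda_i-i+j}(A)\big)_{1\le i,j\le \ell}$ for $\ell\ge$ the length of $\lambda$. Here $k^k$ is the partition with $k$ parts equal to $k$ and $(k-1)^k$ the partition with $k$ parts equal to $k-1$. *)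

(* Defs.v *)
From HB Require Import structures.
From mathcomp Require Import all_boot all_algebra.
From mathcomp Require Import finmap monalg.

Set Implicit Arguments.
Unset Strict Implicit.
Unset Printing Implicit Defensive.

Import GRing.Theory Num.Theory.
Local Open Scope ring_scope.

(* The indeterminate q is 'X : {poly rat}. *)
Definition narayana (n : nat) : {poly rat} :=
  if n is 0 then 1 else
  \sum_(1 <= k < n.+1) (n%:R^-1 * 'C(n, k.-1)%:R * 'C(n, k)%:R) *: 'X^(k.-1).

(* The ring of symmetric functions over rat, as the polynomial ring           *)
(* rat[h_1, h_2, ...] on the complete symmetric functions (these generate it  *)
(* and are algebraically independent). Index i : nat stands for h_(i + 1).    *)
Notation Sym := {malg rat[{cmonom nat}]}.

Definition complete (n : int) : Sym :=
  match n with
  | Posz 0 => 1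
  | Posz m.+1 => << ucm m >>
  | Negz _ => 0
  end.

(* Jacobi-Trudi; a partition is given by the sequence of its parts, possibly  *)
(* followed by zeros, which do not change the value (schur_rcons0).           *)
Definition schur (la : seq nat) : Sym :=
  \det (\matrix_(i < size la, j < size la)
          complete ((nth 0%N la i)%:Z - i%:Z + j%:Z)).

Section Specialization.
Variable c : nat -> {poly rat}.

Definition eval_monom (m : {cmonom nat}) : {poly rat} :=
  \prod_(i <- finsupp m) c i.+1 ^+ m i.

Lemma eval_monomEw (d : {fset nat}) (m : {cmonom nat}) :
  (finsupp m `<=` d)%fset -> eval_monom m = \prod_(i <- d) c i.+1 ^+ m i.
Proof.
move=> le; rewrite /eval_monom (big_fset_incl _ le) //= => i _.
by rewrite -cmE_neq0 negbK => /eqP ->; rewrite expr0.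
Qed.

Lemma eval_monom_is_mmorphism : mmorphism eval_monom.
Proof.
split=> [m1 m2|]; last by rewrite /eval_monom mdom1 big_seq_fset0.
rewrite (eval_monomEw (fsubsetUl (finsupp m1) (finsupp m2))).
rewrite (eval_monomEw (fsubsetUr (finsupp m1) (finsupp m2))).
rewrite /eval_monom mdomD -big_split /=.
by apply: eq_bigr => i _; rewrite cmM exprD.
Qed.

HB.instance Definition _ :=
  monalg.isMultiplicative.Build _ _ eval_monom eval_monom_is_mmorphism.

(* The specialization of Sym with h_n |-> c n for n >= 1. *)
Definition specialize : Sym -> {poly rat} := mmap polyC eval_monom.

HB.instance Definition _ := GRing.RMorphism.on specialize.

Lemma specialize_is_scalable : scalable specialize.
Proof. by move=> a f; rewrite /specialize mmapZ mul_polyC. Qed.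

HB.instance Definition _ :=
  GRing.isScalable.Build rat Sym {poly rat} *:%R specialize
    specialize_is_scalable.

Lemma specialize_complete n : specialize (complete n.+1) = c n.+1.
Proof.
rewrite /specialize mmapU /= polyC1 mul1r.
by rewrite /eval_monom mdomU big_seq_fset1 cmUU.
Qed.

End Specialization.

Definition narayana_alphabet : {lrmorphism Sym -> {poly rat}} :=
  specialize narayana.

Lemma narayana_alphabet_complete (n : nat) :
  narayana_alphabet (complete n) = narayana n.
Proof. by case: n => [|n]; [exact: rmorph1 | exact: specialize_complete]. Qed.

Lemma narayana_alphabet_complete_neg (n : int) :
  (n < 0)%R -> narayana_alphabet (complete n) = 0.
Proof. by case: n => // n _; exact: raddf0. Qed.

Lemma schur_rcons0 (la : seq nat) : schur (rcons la 0%N) = schur la.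
Proof.
rewrite /schur size_rcons (expand_det_row _ ord_max) big_ord_recr /=.
rewrite big1 ?add0r => [|i _]; last first.
  rewrite mxE /= nth_rcons ltnn eqxx sub0r.
  have: (- (size la)%:Z + i%:Z < 0)%R by rewrite addrC subr_lt0 ltz_nat.
  by case: (- _ + _) => // m _; rewrite mul0r.
rewrite mxE /= subrK nth_rcons ltnn eqxx mul1r.
rewrite /cofactor /= addnn -signr_odd odd_double expr0 mul1r.
congr (\det _); apply/matrixP => i j; rewrite !mxE.
have lt_lift (a : 'I_(size la)) : lift ord_max a = a :> nat by exact: lift_max.
by rewrite !lt_lift nth_rcons ltn_ord.
Qed.

(* Main.v *)
(* The Stieltjes matrix [motzkin] of weighted Motzkin paths (level weight 1 + q,
   down weight q) satisfies an LDL^T factorization of the Hankel matrix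
   (C_(i+j+1)) with D = diag(q^k); Narayana numbers enter through its first
   column, evaluated by the reflection principle.  Splitting each step in two
   (the S-fraction with coefficients 1, q, 1, q, ...) gives the same
   factorization for (C_(i+j)).  Reversing the rows turns these Hankel matrices
   into the Jacobi-Trudi ones, with sign (-1)^binomial(k, 2). *)
Require Import Defs.
From mathcomp Require Import all_boot all_algebra.
From mathcomp Require Import monalg.
From mathcomp Require Import ring.

Import GRing.Theory.
Local Open Scope ring_scope.

Fixpoint motzkin (n k : nat) {struct n} : {poly rat} :=
  match n, k with
  | 0, _ => (k == 0)%:R
  | n'.+1, 0 => (1 + 'X) * motzkin n' 0 + 'X * motzkin n' 1
  | n'.+1, k'.+1 =>
      motzkin n' k' + (1 + 'X) * motzkin n' k'.+1 + 'X * motzkin n' k'.+2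
  end.

(** Weighted Dyck prefixes of length [2n] ending at height [2k]; [motzkin n k] is the sum for length
    [2n + 1] and height [2k + 1]. Down steps weigh [1] into even heights and [q] into odd ones. *)
Definition half_motzkin (n k : nat) : {poly rat} :=
  match n, k with
  | 0, _ => (k == 0)%:R
  | n'.+1, 0 => motzkin n' 0
  | n'.+1, k'.+1 => motzkin n' k' + motzkin n' k'.+1
  end.

Lemma motzkin_gt n k : (n < k)%N -> motzkin n k = 0.
Proof.
elim: n k => [|n IH] [|k] //= lt_nk.
by rewrite !IH ?mulr0 ?addr0 // ltnW // ltnW.
Qed.

Lemma motzkin_diag n : motzkin n n = 1.
Proof.
by elim: n => //= n ->; rewrite !motzkin_gt ?mulr0 ?addr0.
Qed.

Lemma half_motzkin_diag n : half_motzkin n n = 1.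
Proof. by case: n => //= n; rewrite motzkin_diag motzkin_gt ?addr0. Qed.

Lemma half_motzkin_gt n k : (n < k)%N -> half_motzkin n k = 0.
Proof.
by case: n k => [|n] [|k] //= lt_nk; rewrite !motzkin_gt ?addr0 // ltnW.
Qed.

Lemma motzkin_half n k :
  motzkin n k = half_motzkin n k + 'X * half_motzkin n k.+1.
Proof. by case: n k => [|n] [|k] /=; ring. Qed.

(** Encode a step by bits [a], [b], with height change [b - a] and weight [q^a]. The first product
    counts all paths, the second those touching height [-1], after reflection. Pascal's rule
    confirms the recursion. *)
Lemma coef_motzkin n k i :
  (motzkin n k)`_i =
    'C(n, i)%:R * 'C(n, i + k)%:R
    - (if i is j.+1 then 'C(n, j)%:R * 'C(n, j + k.+2)%:R else 0).
Proof.
elim: n k i => [|n IH] k i.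
  rewrite /= coefMn coef1 /=.
  by case: i k => [|[|i]] [|k]; rewrite ?bin0n /= ?mulr0 ?mul0r ?subr0.
case: k => [|k]; case: i => [|[|i]] /=;
  rewrite !mulrDl !mul1r !coefD !coefXM /= !IH ?bin0
    ?(addnS, addSn, add0n, addn0, binS) ?bin0 ?natrD; ring.
Qed.

Lemma bin_narayana n j :
  n.+1%:R * ('C(n, j.+1)%:R ^+ 2 - 'C(n, j)%:R * 'C(n, j.+2)%:R)
  = 'C(n.+1, j.+1)%:R * 'C(n.+1, j.+2)%:R :> rat.
Proof.
have := mul_bin_diag n.+1 j.+1; have := mul_bin_diag n.+1 j.
move=> /(congr1 (fun m => m%:R : rat)) e1 /(congr1 (fun m => m%:R : rat)) e2.
move: e1 e2; rewrite /= !binS !(natrM, natrD) -!natr1.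
set A := 'C(n, j)%:R; set B := 'C(n, j.+1)%:R; set D := 'C(n, j.+2)%:R.
set N := n%:R; set J := j%:R => e1 e2.
(* Both sides equal [(N + 1) * A * B]; their difference turns out to be exactly that of the two
   sides of the final goal. *)
have e3 : (J + 1) * (B + A) * B = (J + 1 + 1) * (D + B) * A.
  by rewrite -e1 -e2; ring.
have -> : (N + 1) * (B ^+ 2 - A * D) = (N + 1) * B * B - (N + 1) * A * D
  by ring.
rewrite e1 e2; apply/subr0_eq.
have <- : (J + 1) * (B + A) * B - (J + 1 + 1) * (D + B) * A = 0.
  by rewrite e3 subrr.
by ring.
Qed.

Lemma motzkin_narayana n : motzkin n 0 = narayana n.+1.
Proof.
apply/polyP=> i; rewrite coef_motzkin /narayana coef_sum.
under eq_bigr => k _ do rewrite coefZ coefXn.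
rewrite big_add1 /= big_mkord.
have [lt_in|le_ni] := ltnP i n.+1; last first.
  rewrite big1 => [|j _]; last first.
    by rewrite gtn_eqF ?mulr0 // (leq_trans (ltn_ord j)).
  case: i le_ni => // i le_ni.
  by rewrite !(addnS, addn0) (bin_small le_ni) (bin_small (leqW le_ni));
    rewrite !mulr0 subrr.
rewrite (bigD1 (Ordinal lt_in)) //= eqxx mulr1 big1 ?addr0; last first.
  by move=> j; rewrite -val_eqE eq_sym => /negbTE /= ->; rewrite mulr0.
have n1_neq0 : n.+1%:R != 0 :> rat by rewrite Num.Theory.pnatr_eq0.
apply: (mulfI n1_neq0); rewrite !mulrA divff // mul1r.
case: i {lt_in} => [|i]; first by rewrite !bin0 bin1 subr0 !mulr1 mul1r.
by rewrite !(addnS, addn0) -bin_narayana expr2.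
Qed.

Lemma half_motzkin_narayana n : half_motzkin n 0 = narayana n.
Proof. by case: n => // n; exact: motzkin_narayana. Qed.

(** The two kinds of half step are adjoint for the weights [q^k], so a half step passes from the
    left factor to the right one. *)
Lemma sum_half_motzkinS m n K : (n < K)%N ->
  \sum_(k < K) half_motzkin m.+1 k * 'X^k * half_motzkin n k
  = \sum_(k < K) motzkin m k * 'X^k * motzkin n k.
Proof.
case: K => // K lt_nK.
under [RHS]eq_bigr => k _ do rewrite (motzkin_half n) mulrDr.
rewrite big_split [X in _ = _ + X]big_ord_recr /=.
rewrite (half_motzkin_gt _ _ lt_nK) !mulr0 addr0.
rewrite big_ord_recl [X in _ = X + _]big_ord_recl /= -addrA; congr (_ + _).
rewrite -big_split; apply: eq_bigr => k _ /=.
by rewrite /bump /= !add1n exprS; ring.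
Qed.

Lemma sum_half_motzkin m n K : (n < K)%N ->
  \sum_(k < K) half_motzkin m k * 'X^k * half_motzkin n k = narayana (m + n).
Proof.
move=> lt_nK.
(* The induction lowers [m] and raises [n], so the range is first enlarged past the invariant
   [m + n]; the added terms vanish since [n < K]. *)
suff large M : (m + n < M)%N ->
    \sum_(k < M) half_motzkin m k * 'X^k * half_motzkin n k = narayana (m + n).
  rewrite -(large (m + n + K).+1) ?ltnS ?leq_addr //.
  rewrite (big_ord_widen (m + n + K).+1
    (fun k => half_motzkin m k * 'X^k * half_motzkin n k)); last first.
    by rewrite leqW // leq_addl.
  rewrite big_mkcond; apply: eq_bigr => k _; case: ltnP => // le_Kk.
  by rewrite (half_motzkin_gt n) ?mulr0 // (leq_trans lt_nK).
move=> {K lt_nK}; elim: m n => [|m IH] n lt_M.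
  case: M lt_M => // M _; rewrite big_ord_recl big1 => [|k _] /=.
    by rewrite !mul1r addr0 half_motzkin_narayana.
  by rewrite !mul0r.
rewrite sum_half_motzkinS; last by apply: leq_trans lt_M; rewrite ltnS leq_addl.
rewrite addSnnS -IH -?addSnnS //.
have lt_mM : (m < M)%N.
  by apply: leq_trans lt_M; rewrite ltnS addSn leqW // leq_addr.
(* With the factors swapped, the same adjointness read backwards attaches the second half step to
   [n]. *)
under eq_bigr => k _ do rewrite mulrAC (mulrC (motzkin m k)) mulrAC.
rewrite -sum_half_motzkinS //; apply: eq_bigr => k _.
by ring.
Qed.

Lemma sum_motzkin m n K : (n < K)%N ->
  \sum_(k < K) motzkin m k * 'X^k * motzkin n k = narayana (m + n).+1.
Proof. by move=> lt_nK; rewrite -sum_half_motzkinS // sum_half_motzkin. Qed.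

Lemma det_LDLT (R : comNzRingType) n (l : nat -> nat -> R) (d : nat -> R) :
  (forall i, l i i = 1) -> (forall i j, (i < j)%N -> l i j = 0) ->
  \det (\matrix_(i < n, j < n) \sum_(k < n) l i k * d k * l j k)
    = \prod_(k < n) d k.
Proof.
move=> l1 l0; pose L := \matrix_(i < n, j < n) l i j.
have detL : \det L = 1.
  rewrite det_trig; first by rewrite big1 // => i _; rewrite mxE.
  by apply/is_trig_mxP => i j lt_ij; rewrite mxE l0.
have -> : \matrix_(i < n, j < n) \sum_(k < n) l i k * d k * l j k
    = L *m diag_mx (\row_k d k) *m L^T.
  apply/matrixP => i j; rewrite mul_mx_diag !mxE.
  by apply: eq_bigr => k _; rewrite !mxE.
rewrite !det_mulmx det_tr detL mul1r mulr1 det_diag.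
by apply: eq_bigr => k _; rewrite mxE.
Qed.

Lemma prod_expr_ord (R : comNzRingType) (x : R) n :
  \prod_(i < n) x ^+ i = x ^+ 'C(n, 2).
Proof.
by rewrite prodrXr -bin2_sum big_mkord.
Qed.

Lemma det_antidiag (R : comNzRingType) n :
  \det (\matrix_(i < n, j < n) (j == rev_ord i)%:R) = (-1) ^+ 'C(n, 2) :> R.
Proof.
elim: n => [|n IH]; first by rewrite det_mx00.
(* Only the last entry of the first row is nonzero; its cofactor sign [(-1)^n] matches
   ['C(n.+1, 2) = 'C(n, 2) + n]. *)
rewrite (expand_det_row _ ord0) (bigD1 ord_max) //= big1 ?addr0; last first.
  move=> j /negbTE nj; rewrite mxE.
  have -> : rev_ord (@ord0 n) = ord_max by apply: val_inj; rewrite /= subn1.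
  by rewrite nj mul0r.
rewrite mxE -val_eqE /= subn1 eqxx mul1r /cofactor /= add0n.
rewrite binS bin1 addnC exprD -IH; congr (_ * \det _).
apply/matrixP => i j; rewrite !mxE -!val_eqE /= /bump /= add1n subSS.
by rewrite leqNgt ltn_ord.
Qed.

Lemma det_rev_rows (R : comNzRingType) n (a : nat -> nat -> R) :
  \det (\matrix_(i < n, j < n) a (n - i.+1)%N j)
    = (-1) ^+ 'C(n, 2) * \det (\matrix_(i < n, j < n) a i j).
Proof.
rewrite -det_antidiag -det_mulmx; congr (\det _).
apply/matrixP => i j; rewrite !mxE (bigD1 (rev_ord i)) //= big1.
  by rewrite !mxE eqxx mul1r addr0.
by move=> k /negbTE nk; rewrite !mxE nk mul0r.
Qed.

(** Row reversal gives index [k - 1 - i + j], and the extra one in [sum_motzkin] makes it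
    [k - i + j]; hence [motzkin] serves parts [k] and [half_motzkin] parts [k - 1]. *)
Lemma det_narayana k :
  \det (\matrix_(i < k, j < k) narayana (k - i + j)%N) = (- 'X) ^+ 'C(k, 2).
Proof.
rewrite -mulN1r exprMn -(prod_expr_ord _ 'X).
rewrite -(det_LDLT _ _ _ _ motzkin_diag motzkin_gt).
have /= <- :=
  det_rev_rows _ k (fun i j => \sum_(l < k) motzkin i l * 'X^l * motzkin j l).
congr (\det _); apply/matrixP => i j; rewrite !mxE.
by rewrite sum_motzkin // -addSn subnSK.
Qed.

Lemma det_narayana_pred k :
  \det (\matrix_(i < k, j < k) narayana (k - 1 - i + j)%N)
    = (- 'X) ^+ 'C(k, 2).
Proof.
rewrite -mulN1r exprMn -(prod_expr_ord _ 'X).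
rewrite -(det_LDLT _ _ _ _ half_motzkin_diag half_motzkin_gt).
have /= <- :=
  det_rev_rows _ k (fun i j =>
    \sum_(l < k) half_motzkin i l * 'X^l * half_motzkin j l).
congr (\det _); apply/matrixP => i j; rewrite !mxE.
by rewrite sum_half_motzkin // -subnDA add1n.
Qed.

Lemma narayana_alphabet_schur n la : size la = n ->
  narayana_alphabet (schur la)
  = \det (\matrix_(i < n, j < n)
      narayana_alphabet (complete ((nth 0%N la i)%:Z - i%:Z + j%:Z))).
Proof.
move=> <-; rewrite /schur -det_map_mx; congr (\det _).
by apply/matrixP => i j; rewrite !mxE.
Qed.

(** The bound gives [i <= l] for every row, so no negative index occurs and truncated subtraction
    agrees with that of integers. *)
Lemma narayana_alphabet_schur_rect k l : (k <= l.+1)%N ->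
  narayana_alphabet (schur (nseq k l))
  = \det (\matrix_(i < k, j < k) narayana (l - i + j)%N).
Proof.
move=> le_kl; rewrite (narayana_alphabet_schur k) ?size_nseq //.
congr (\det _); apply/matrixP => i j; rewrite !mxE nth_nseq ltn_ord.
have le_il : (i <= l)%N by rewrite -ltnS (leq_trans (ltn_ord i)).
by rewrite subzn // -PoszD narayana_alphabet_complete.
Qed.

Theorem theorem7 (k : nat) (hk : (1 <= k)%N) :
  [/\ narayana_alphabet (schur (nseq k k)) = (- 'X) ^+ 'C(k, 2),
      narayana_alphabet (schur (nseq k (k - 1)%N)) = (- 'X) ^+ 'C(k, 2),
      \det (\matrix_(i < k, j < k) narayana (k - i + j)%N)
        = (- 'X) ^+ ((k * (k - 1)) %/ 2)%N
    & \det (\matrix_(i < k, j < k) narayana (k - 1 - i + j)%N)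
        = (- 'X) ^+ ((k * (k - 1)) %/ 2)%N].
Proof.
have <- : 'C(k, 2) = ((k * (k - 1)) %/ 2)%N by rewrite bin2 divn2 subn1.
by split; rewrite ?narayana_alphabet_schur_rect ?det_narayana
  ?det_narayana_pred // subn1 prednK.
Qed.
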